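(* Let $T=(V,L)$ be a substrate tree with capacities $c_h$ and bandwidths $b_v$ as described in the context, and let $\mathcal{J}=\langle N,B\rangle$ be a request. Then Algorithm 1 (the dynamic program described in the context) returns an optimal solution of the Survivable Virtual Cluster Embedding Problem (an SVCE of $\mathcal{J}$ using the minimum total number of VM slots $\sum_{h\in H}\mathcal{C}_s(h)$) if the instance is feasible (i.e. some SVCE of $\mathcal{J}$ exists), and returns ''Infeasible'' otherwise.
   Context: Substrate: an undirected tree $T=(V,L)$ with $V=H\cup S$ (disjoint), where $H$ is the set of physical machines (PMs), which are exactly the leaves, and $S$ is the set of switches (internal nodes). The tree is rooted at a fixed node $r\in S$. For $v\in V$, $T_v$ is the subtree rooted at $v$, $l_v$ is the out-bound link of $T_v$ (the link from $v$ to its parent; the root has none), and $d_v$ is the number of children of $v$, which are ordered $u_1,\dots,u_{d_v}$. Each PM $h$ has $c_h\in\mathbb{Z}_{\ge0}$ available VM slots; each non-root node $v$ has available bandwidth $b_v\ge 0$ on $l_v$ (for the root we use the convention $b_r=+\infty$). A request is $\mathcal{J}=\langle N,B\rangle$ with $N$ a positive integer (number of VMs) and $B>0$ (per-VM bandwidth). VCE: given a tree with PM capacities $c_h$ and link bandwidths $b_v$, a virtual cluster embedding of $\langle N,B\rangle$ is a function $\mathcal{C}:H\to\mathbb{Z}_{\ge 0}$ with $\mathcal{C}(h)\le c_h$ for all $h$, $\sum_{h\in H}\mathcal{C}(h)=N$, and $\min\{n_v,N-n_v\}\cdot B\le b_v$ for every link $l_v$, where $n_v=\sum_{h\in H\cap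 T_v}\mathcal{C}(h)$. SVCE: a pair $(\mathcal{C}_s,\mathcal{B}_s)$ with $\mathcal{C}_s:H\to\mathbb{Z}_{\ge0}$, $\mathcal{C}_s(h)\le c_h$, and $\mathcal{B}_s:L\to\mathbb{R}_{\ge 0}$, $\mathcal{B}_s(l_v)\le b_v$, such that for every PM $F\in H$ there exists a VCE of $\mathcal{J}$ in the tree $(V\setminus\{F\},L\setminus\{l_F\})$ whose PM capacities are $\mathcal{C}_s(h)$ ($h\ne F$) and whose link bandwidths are $\mathcal{B}_s(l_v)$. The Survivable Virtual Cluster Embedding Problem (SVCEP) asks for an SVCE minimizing $\sum_{h\in H}\mathcal{C}_s(h)$. Notation: $\Lambda_v=\big([0,b_v/B]\cup[N-b_v/B,N]\big)\cap[0,N]$, $\overline\Lambda_v=[0,N]\setminus\Lambda_v$, and, when $N-b_v/B>N/2$, $\lambda_v=\lceil N-b_v/B\rceil$ (this is the case whenever $\overline\Lambda_v\neq\emptyset$). For $x\in\{0,\dots,N\}$ let $m_v(x)=x$ if $x\in\Lambda_v$ and $m_v(x)=\lambda_v$ if $x\in\overline\Lambda_v$. Algorithm 1: processing nodes bottom-up, it computes tables indexed by $n_0,n_1\in\{0,\dots,N\}$. For a PM $h$: $N_h[n_0,n_1]=n_0$ if $n_1=0$ and $n_0\in[0,c_h]\cap\Lambda_h$; $N_h[n_0,n_1]=\lambda_h$ if $n_1=0$, $n_0\in\overline\Lambda_h$ and $\lambda_h\le c_h$; and $N_h[n_0,n_1]=\infty$ otherwise. For a switch $v$: $N'_v[n_0,n_1,0]=0$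 if $n_0=n_1=0$ and $\infty$ otherwise; for $k=1,\dots,d_v$, $N'_v[n_0,n_1,k]=\min\{N'_v[n_0',n_1',k-1]+N_{u_k}[n_0'',n_1'']\}$, the minimum over $n_0',n_1',n_0'',n_1''\in\{0,\dots,N\}$ with $n_0'+n_0''\ge n_0$ and $\min\{n_0'+n_1'',\,n_0''+n_1'\}\ge n_1$; finally $N_v[n_0,n_1]=N'_v[m_v(n_0),m_v(n_1),d_v]$. ($N_v[n_0,n_1]$ is intended as the minimum number of VMs to place in $T_v$ so that $T_v$ offers at least $n_0$ working VMs with no failure and at least $n_1$ working VMs under any single-PM failure in $T_v$, respecting bandwidths.) If $N_r[N,N]=\infty$ the algorithm returns ''Infeasible''; otherwise it backtracks through the minimizing choices to obtain the VM allocation $\mathcal{C}_s(h)$ for each PM and sets each $\mathcal{B}_s(l_v)$ to the hose-model bandwidth $B\cdot\max\{\min\{a_0,N-a_0\},\min\{a_1,N-a_1\}\}$ determined by the numbers $a_0,a_1$ of working VMs chosen for $T_v$, and returns $(\mathcal{C}_s,\mathcal{B}_s)$. *)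

(* Defs.v *)
From HB Require Import structures.
From mathcomp Require Import all_boot all_order all_algebra.
From mathcomp Require Import reals.
Set Implicit Arguments. Unset Strict Implicit. Unset Printing Implicit Defensive.
Import Order.TTheory GRing.Theory Num.Theory.
Local Open Scope ring_scope.

Section SVCE.
Variable R : realType.

(** * Substrate trees
   A non-root node of the substrate is either a PM  [Leaf c b]  (with
   [c] available VM slots and available bandwidth [b] on its out-bound
   link) or a switch [Node b ch] (bandwidth [b] on its out-bound link,
   ordered children [ch]).  The whole substrate is represented by the
   ordered list of children of the root switch [r] (the root has no
   out-bound link, i.e. b_r = +oo).  A node is addressed by the sequence
   of (0-based) child indices on the path from the root; the root has
   address [::]. *)
Inductive tree := Leaf of nat & R | Node of R & seq tree.

Definition is_leafb (t : tree) : bool := if t is Leaf _ _ then true else false.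
Definition bwd (t : tree) : R := match t with Leaf _ b => b | Node b _ => b end.

Fixpoint nodes (t : tree) : seq (seq nat * tree) :=
  ([::], t) :: match t with
               | Leaf _ _ => [::]
               | Node _ ch =>
                 (fix go (l : seq tree) (i : nat) :=
                    match l with
                    | [::] => [::]
                    | u :: l' => [seq (i :: x.1, x.2) | x <- nodes u] ++ go l' i.+1
                    end) ch 0%N
               end.

Definition nonroot_nodes (ch : seq tree) := behead (nodes (Node 0 ch)).
Definition addrs (ch : seq tree) : seq (seq nat) := [seq x.1 | x <- nonroot_nodes ch].
Definition pms (ch : seq tree) : seq (seq nat) :=
  [seq x.1 | x <- nonroot_nodes ch & is_leafb x.2].

Fixpoint sub (t : tree) (p : seq nat) : option tree :=
  match p with
  | [::] => Some t
  | i :: p' => match t with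
               | Leaf _ _ => None
               | Node _ ch => obind (fun u => sub u p') (nth None (map Some ch) i)
               end
  end.

Definition cap (ch : seq tree) (h : seq nat) : nat :=
  if sub (Node 0 ch) h is Some (Leaf c _) then c else 0%N.
Definition bwt (ch : seq tree) (v : seq nat) : R :=
  if sub (Node 0 ch) v is Some u then bwd u else 0.

(** well-formedness: the PMs are exactly the leaves, i.e. every switch
    (including the root) has at least one child *)
Fixpoint wf_tree (t : tree) : bool :=
  match t with
  | Leaf _ _ => true
  | Node _ ch => (0 < size ch)%N && all wf_tree ch
  end.
Definition wf_substrate (ch : seq tree) : bool := (0 < size ch)%N && all wf_tree ch.

Variables (N : nat) (B : R).

(** A VCE of <N,B> in the substrate with the PM [F] removed (or nothing
    removed when [F = None]), with PM capacities [capf] and link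
    bandwidths [bwf].  n_v is the number of VMs placed on the remaining
    PMs of T_v. *)
Definition VCE (ch : seq tree) (F : option (seq nat))
    (capf : seq nat -> nat) (bwf : seq nat -> R) (C : seq nat -> nat) : Prop :=
  let H := [seq h <- pms ch | Some h != F] in
  let nv := fun v => (\sum_(h <- H | prefix v h) C h)%N in
  (forall h, h \in H -> C h <= capf h)%N /\
  (\sum_(h <- H) C h)%N = N /\
  (forall v, v \in addrs ch -> Some v != F ->
     (minn (nv v) (N - nv v))%:R * B <= bwf v).

Definition SVCE (ch : seq tree) (Cs : seq nat -> nat) (Bs : seq nat -> R) : Prop :=
  (forall h, h \in pms ch -> Cs h <= cap ch h)%N /\
  (forall v, v \in addrs ch -> 0 <= Bs v <= bwt ch v) /\
  (forall F, F \in pms ch -> exists C, VCE ch (Some F) Cs Bs C).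

Definition cost (ch : seq tree) (Cs : seq nat -> nat) : nat := (\sum_(h <- pms ch) Cs h)%N.

Definition optimal_SVCE (ch : seq tree) (Cs : seq nat -> nat) (Bs : seq nat -> R) : Prop :=
  SVCE ch Cs Bs /\
  forall Cs' Bs', SVCE ch Cs' Bs' -> (cost ch Cs <= cost ch Cs')%N.

(** extended naturals: [None] is +oo *)
Definition xnat := option nat.
Definition xadd (a b : xnat) : xnat :=
  match a, b with Some x, Some y => Some (x + y)%N | _, _ => None end.
Definition xmin (a b : xnat) : xnat :=
  match a, b with
  | None, _ => b
  | _, None => a
  | Some x, Some y => Some (minn x y)
  end.
Definition xminl (s : seq xnat) : xnat := foldr xmin None s.

Definition inLam (b : R) (x : nat) : bool :=
  (x%:R <= b / B) || (N%:R - b / B <= x%:R).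
(** lambda_v = ceil(N - b_v/B) (only used when x \notin Lambda_v, where
    it is a positive integer) *)
Definition lam (b : R) : nat := absz (Num.ceil (N%:R - b / B)).
Definition mv (b : R) (x : nat) : nat := if inLam b x then x else lam b.

Definition leaf_tab (c : nat) (b : R) (n0 n1 : nat) : xnat :=
  if n1 == 0%N then
    if (n0 <= c)%N && inLam b n0 then Some n0
    else if ~~ inLam b n0 && (lam b <= c)%N then Some (lam b)
    else None
  else None.

Definition rng : seq nat := iota 0 N.+1.
Definition pairs : seq (nat * nat) := [seq (x, y) | x <- rng, y <- rng].

(** N'_v[.,.,k] from N'_v[.,.,k-1] (= g) and N_{u_k} (= f) *)
Definition step (g f : nat -> nat -> xnat) (n0 n1 : nat) : xnat :=
  xminl [seq xadd (g a.1.1 a.1.2) (f a.2.1 a.2.2)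
        | a <- [seq (a', a'') | a' <- pairs, a'' <- pairs]
        & (n0 <= a.1.1 + a.2.1)%N && (n1 <= minn (a.1.1 + a.2.2) (a.2.1 + a.1.2))%N].

Definition base (n0 n1 : nat) : xnat := if (n0 == 0%N) && (n1 == 0%N) then Some 0%N else None.

(** N'_v[.,.,k], where [fs] lists the tables of the children u_1..u_d *)
Definition Npr (fs : seq (nat -> nat -> xnat)) (k : nat) : nat -> nat -> xnat :=
  foldl step base (take k fs).

Fixpoint tab (t : tree) : nat -> nat -> xnat :=
  match t with
  | Leaf c b => leaf_tab c b
  | Node b ch => fun n0 n1 => Npr (map tab ch) (size ch) (mv b n0) (mv b n1)
  end.

(** the table N_r of the root (b_r = +oo, so m_r is the identity) *)
Definition root_tab (ch : seq tree) (n0 n1 : nat) : xnat :=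
  Npr (map tab ch) (size ch) n0 n1.

(** hose-model bandwidth for a0, a1 working VMs *)
Definition bwreq (a0 a1 : nat) : R :=
  B * (maxn (minn a0 (N - a0)) (minn a1 (N - a1)))%:R.

(** a minimizing choice at stage k = i+1 of a switch with children
    tables [fs]: from entry (z0,z1) of N'[.,.,i+1], go to entry (x0,x1)
    of N'[.,.,i] and entry (y0,y1) of the table [f] of child u_{i+1}. *)
Definition choice_ok (fs : seq (nat -> nat -> xnat)) (f : nat -> nat -> xnat)
    (i x0 x1 y0 y1 z0 z1 : nat) : Prop :=
  [&& x0 <= N, x1 <= N, y0 <= N, y1 <= N, z0 <= x0 + y0
    & z1 <= minn (x0 + y1) (y0 + x1)]%N /\
  Npr fs i.+1 z0 z1 <> None /\
  Npr fs i.+1 z0 z1 = xadd (Npr fs i x0 x1) (f y0 y1).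

(** [BT t p n0 n1 C Bs]: backtracking from entry N_v[n0,n1] of the node
    v at address p with subtree t, through minimizing choices, produces
    the values of C (at the PMs of T_v) and Bs (at the links of T_v,
    including l_v).  The numbers of working VMs chosen for T_v are
    a0 = m_v(n0), a1 = m_v(n1), the entry of N'_v used. *)
Fixpoint BT (t : tree) (p : seq nat) (n0 n1 : nat)
    (C : seq nat -> nat) (Bs : seq nat -> R) : Prop :=
  match t with
  | Leaf c b =>
      (exists k, leaf_tab c b n0 n1 = Some k /\ C p = k) /\
      Bs p = bwreq (mv b n0) (mv b n1)
  | Node b ch =>
      Bs p = bwreq (mv b n0) (mv b n1) /\
      exists s0 s1 q0 q1 : nat -> nat,
        s0 (size ch) = mv b n0 /\ s1 (size ch) = mv b n1 /\
        s0 0%N = 0%N /\ s1 0%N = 0%N /\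
        (fix go (l : seq tree) (i : nat) : Prop :=
           match l with
           | [::] => True
           | u :: l' =>
               choice_ok (map tab ch) (tab u) i (s0 i) (s1 i) (q0 i) (q1 i)
                         (s0 i.+1) (s1 i.+1) /\
               BT u (rcons p i) (q0 i) (q1 i) C Bs /\ go l' i.+1
           end) ch 0%N
  end.

Definition BT_root (ch : seq tree) (C : seq nat -> nat) (Bs : seq nat -> R) : Prop :=
  exists s0 s1 q0 q1 : nat -> nat,
    s0 (size ch) = N /\ s1 (size ch) = N /\ s0 0%N = 0%N /\ s1 0%N = 0%N /\
    (fix go (l : seq tree) (i : nat) : Prop :=
       match l with
       | [::] => True
       | u :: l' =>
           choice_ok (map tab ch) (tab u) i (s0 i) (s1 i) (q0 i) (q1 i)
                     (s0 i.+1) (s1 i.+1) /\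
           BT u [:: i] (q0 i) (q1 i) C Bs /\ go l' i.+1
       end) ch 0%N.

Inductive result := Infeasible | Solution of (seq nat -> nat) & (seq nat -> R).

(** [alg_returns ch res]: Algorithm 1 (with some choice among the
    minimizers during backtracking) may return [res]. *)
Definition alg_returns (ch : seq tree) (res : result) : Prop :=
  match res with
  | Infeasible => root_tab ch N N = None
  | Solution Cs Bs => root_tab ch N N <> None /\ BT_root ch Cs Bs
  end.

End SVCE.

(* Main.v *)
Require Import Defs.
From HB Require Import structures.
From mathcomp Require Import all_boot all_order all_algebra.
From mathcomp Require Import reals.
From mathcomp Require Import zify.
Import Order.TTheory GRing.Theory Num.Theory.
Local Open Scope ring_scope.
Set Implicit Arguments. Unset Strict Implicit. Unset Printing Implicit Defensive.

(** Fix a placement of VM slots and let A_v be the number of VMs that T_v can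
   run when the numbers of working VMs are rounded down, bottom-up, into the
   allowed sets Lambda_v = [0,k_v] u [N-k_v,N].  A_v bounds every embedding,
   but because of the gaps the values below A_v need not all be attainable.
   The symmetry of Lambda_v under x -> N - x repairs this: every n with
   n <= A_v and n <= N - A_v is attainable in T_v.  Hence if the children of
   the root offer at least N altogether, an exact total of N is reached by
   letting a child of maximal A_u run A_u VMs, the other ones sharing the
   remaining N - A_u.  So "offers at least n", which is what the dynamic
   program computes, is the right notion: with k_v taken from the available
   bandwidths it shows that the table bounds the cost of every SVCE from below,
   and with k_v taken from the bandwidths chosen by the backtracking it shows
   that the returned pair is an SVCE. *)

(** * Finite choices, minima and sums *)

Lemma finite_choice (T : Type) (x0 : T) (n : nat) (P : nat -> T -> Prop) :
  (forall i, (i < n)%N -> exists x, P i x) ->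
  exists f, forall i, (i < n)%N -> P i (f i).
Proof.
elim: n => [|n IH] h; first by exists (fun=> x0).
have [i Hi|f Hf] := IH; first by apply: h; lia.
have [x Hx] := h n (leqnn _).
exists (fun i => if i == n then x else f i) => i Hi.
by case: eqP => [->//|ne]; apply: Hf; lia.
Qed.

(** The value [m] starts the minimum, which therefore exists also for [n = 0]. Used to pick a worst
    failure. *)
Lemma least_value (n m : nat) (g : nat -> nat) :
  exists y, [/\ (y <= m)%N, forall j, (j < n)%N -> (y <= g j)%N
            & y = m \/ exists2 j, (j < n)%N & y = g j].
Proof.
elim: n => [|n [y [ym yg yE]]]; first by exists m; split=> //; left.
exists (minn y (g n)); split; first by lia.
  by move=> j; rewrite ltnS leq_eqVlt => /orP[/eqP->|/yg]; lia.
case: (leqP y (g n)) => h; last by right; exists n.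
by case: yE => [->|[j Hj ->]]; [left|right; exists j => //; lia].
Qed.

Lemma split_sum (n t : nat) (a : nat -> nat) : (t <= \sum_(i < n) a i)%N ->
  exists s : nat -> nat, (forall i, (i < n)%N -> (s i <= a i)%N) /\
    (\sum_(i < n) s i)%N = t.
Proof.
elim: n t => [|n IH] t.
  by rewrite big_ord0 leqn0 => /eqP->; exists (fun=> 0%N); rewrite big_ord0.
rewrite big_ord_recr /= => h.
have [|s [sa sE]] := IH (t - minn t (a n))%N.
  by move: (bigop _ _ _) h => S; lia.
exists (fun i => if i == n then minn t (a n) else s i); split.
  by move=> i Hi; case: eqP => [->|ne]; [lia|apply: sa; lia].
rewrite big_ord_recr /= eqxx (eq_bigr (fun i : 'I_n => s i)) ?sE; first by lia.
by move=> i _; case: eqP => // /eqP; rewrite ltn_eqF.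
Qed.

(** * Induction on substrate trees, addresses and totals *)

Section Tree.
Variable R : realType.
Implicit Types (t u : tree R) (ch : seq (tree R)).

Definition d0 : tree R := Leaf 0 0.

(** Children sit in a list, so a usable induction hypothesis must be supplied by hand; it is indexed
    by position, as addresses are. *)
Lemma tree_nested_ind (P : tree R -> Prop) :
  (forall c b, P (Leaf c b)) ->
  (forall b ch, (forall i, (i < size ch)%N -> P (nth d0 ch i)) -> P (Node b ch)) ->
  forall t, P t.
Proof.
move=> PL PN; fix IH 1 => -[c b|b ch]; first exact: PL.
apply: PN; elim: ch => [i Hi|u l IHl [_|i]]; [|exact: IH|exact: IHl].
by exfalso; move: Hi; rewrite ltn0.
Qed.

Lemma sub_Node b ch i x :
  sub (Node b ch) (i :: x) = if (i < size ch)%N then sub (nth d0 ch i) x else None.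
Proof.
rewrite /=; case: ltnP => Hi; first by rewrite (nth_map d0).
by rewrite nth_default // size_map.
Qed.

Lemma nodes_Node b ch : nodes (Node b ch) = ([::], Node b ch) ::
  flatten [seq [seq (i :: x.1, x.2) | x <- nodes (nth d0 ch i)] | i <- iota 0 (size ch)].
Proof.
rewrite [LHS]/=; congr (_ :: _).
have E m : [seq [seq (i :: x.1, x.2) | x <- nodes (nth d0 ch (i - m))] | i <- iota m (size ch)]
   = [seq [seq ((m + i)%N :: x.1, x.2) | x <- nodes (nth d0 ch i)] | i <- iota 0 (size ch)].
  rewrite -[m in iota m _]addn0 iotaDl -map_comp.
  by apply: eq_map => i /=; rewrite addKn.
(* The index is written [i - 0] so that the induction below can generalise the initial value of the
   counter. *)
transitivity (flatten [seq [seq (i :: x.1, x.2) | x <- nodes (nth d0 ch (i - 0))]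
                      | i <- iota 0 (size ch)]); last first.
  by congr flatten; apply: eq_map => i; rewrite subn0.
elim: ch 0%N {E} => //= u l IH m; rewrite subnn /= IH.
congr (_ ++ flatten _); apply/eq_in_map => i; rewrite mem_iota => /andP[h _].
by rewrite -[(i - m)%N]prednK ?subn_gt0 //= subnS.
Qed.

(** One enumeration for two uses: [is_leafb] selects the PMs, [predT] the addresses of all nodes,
    the root included. *)
Definition paths (a : pred (tree R)) t := [seq x.1 | x <- nodes t & a x.2].
Notation leaves := (paths (@is_leafb R)).

Lemma paths_Node a b ch : paths a (Node b ch) =
  (if a (Node b ch) then [:: [::]] else [::]) ++
  flatten [seq [seq i :: x | x <- paths a (nth d0 ch i)] | i <- iota 0 (size ch)].
Proof.
rewrite /paths nodes_Node [filter _ _]/=.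
suff E : [seq x.1 | x <- flatten [seq [seq (i :: x.1, x.2) | x <- nodes (nth d0 ch i)]
   | i <- iota 0 (size ch)] & a x.2] =
  flatten [seq [seq i :: x | x <- paths a (nth d0 ch i)] | i <- iota 0 (size ch)].
  by case: ifP => _ /=; rewrite E.
rewrite filter_flatten map_flatten -!map_comp; congr flatten.
by apply: eq_map => i /=; rewrite filter_map -!map_comp.
Qed.

Lemma mem_paths a t x : (x \in paths a t) = (if sub t x is Some u then a u else false).
Proof.
elim/tree_nested_ind: t x => [c b|b ch IH] x.
  by rewrite /paths /=; case: ifP => aL; case: x => [|i x] //=; rewrite ?inE aL.
rewrite paths_Node mem_cat; case: x => [|i x].
  rewrite [sub _ _]/= (_ : (_ \in flatten _) = false) ?orbF; last first.
    by apply/negbTE/flattenP => -[s /mapP[i _ ->]] /mapP[].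
  by case: ifP.
rewrite (_ : (_ \in if _ then _ else _) = false) /=; last by case: ifP.
rewrite -/(sub (Node b ch) (i :: x)) sub_Node.
apply/idP/idP.
  case/flattenP => s /mapP[j]; rewrite mem_iota add0n => /= Hj -> /mapP[y Hy [-> ->]].
  by rewrite Hj -IH.
case: ltnP => // Hi; rewrite -IH // => Hx; apply/flattenP.
exists [seq i :: x | x <- paths a (nth d0 ch i)]; last by rewrite map_f.
by apply/mapP; exists i => //; rewrite mem_iota.
Qed.

Definition total t (C : seq nat -> nat) : nat := (\sum_(h <- leaves t) C h)%N.

Lemma big_leaves_Node b ch (P : pred (seq nat)) (C : seq nat -> nat) :
  (\sum_(h <- leaves (Node b ch) | P h) C h =
   \sum_(i < size ch) \sum_(h <- leaves (nth d0 ch i) | P (val i :: h)) C (val i :: h))%N.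
Proof.
rewrite paths_Node /= big_flatten big_map.
rewrite (_ : iota 0 (size ch) = index_iota 0 (size ch)); last by rewrite /index_iota subn0.
by rewrite big_mkord; apply: eq_bigr => i _; rewrite big_map.
Qed.

Lemma total_Node b ch C :
  total (Node b ch) C = (\sum_(i < size ch) total (nth d0 ch i) (fun x => C (val i :: x)))%N.
Proof. exact: big_leaves_Node. Qed.

Lemma total_Leaf c b C : total (Leaf c b) C = C [::].
Proof. by rewrite /total /paths /= big_seq1. Qed.

(** Identifies the n_v of [VCE], a sum over addresses with prefix v, with the total of the subtree
    at v. *)
Lemma total_prefix t v u C : sub t v = Some u ->
  (\sum_(h <- leaves t | prefix v h) C h)%N = total u (fun x => C (v ++ x)).
Proof.
elim: v t C => [|i v IH] t C.
  by move=> [->]; apply: eq_bigl => h; rewrite prefix0s.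
case: t => // b ch; rewrite sub_Node; case: ltnP => // Hi Hu.
rewrite big_leaves_Node (bigD1 (Ordinal Hi)) //= eqxx /= (IH _ (fun x => C (i :: x))) //.
rewrite big1 ?addn0 // => j; rewrite -val_eqE /= => ne.
by rewrite big1 // => x; rewrite eq_sym (negbTE ne).
Qed.

End Tree.
Notation leaves := (paths (@is_leafb _)).

(** * Placements offered by a subtree *)

Section Availability.
Variables (R : realType) (N : nat).
Implicit Types (t u : tree R) (ch : seq (tree R)) (K : seq nat -> nat).
Notation nthd ch i := (nth (d0 R) ch i).

(* For [k = floor (b_v / B)] this is membership in Lambda_v. *)
Definition fits (k x : nat) : bool := ((x <= N) && (minn x (N - x) <= k))%N.

(** The largest allowed value up to [x]: in the gap k < x < N - k it is [k]. For x > N the truncated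
    difference is 0, the test succeeds and the value is N. *)
Definition rdown (k x : nat) : nat :=
  (if minn x (N - x) <= k then minn x N else k)%N.

Lemma rdown_le k x : (rdown k x <= x)%N.
Proof. by rewrite /rdown; case: ifP; lia. Qed.

Lemma rdown_leN k x : (rdown k x <= N)%N.
Proof. by rewrite /rdown; case: ifP; lia. Qed.

Lemma rdown_max k x y : fits k y -> (y <= x)%N -> (y <= rdown k x)%N.
Proof. by rewrite /fits /rdown; case: ifP; lia. Qed.

Lemma fits_rdown k x : fits k (rdown k x).
Proof. by rewrite /fits /rdown; case: ifP; lia. Qed.

(** The integer form of m_v: for [x] in the gap, N - k is the least allowed value above it. *)
Definition rup (k x : nat) : nat :=
  (if minn x (N - x) <= k then x else N - k)%N.

Lemma fits_rup k x : (x <= N)%N -> fits k (rup k x).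
Proof. by rewrite /fits /rup; case: ifP; lia. Qed.

Lemma rup_ge k x : (x <= N)%N -> (x <= rup k x)%N.
Proof. by rewrite /rup; case: ifP; lia. Qed.

(** [rdown k y] is itself allowed, and [rup k x] is the least allowed value from [x] on. *)
Lemma rup_le k x y : (x <= rdown k y)%N -> (rup k x <= rdown k y)%N.
Proof. by rewrite /rup /rdown; do 2!case: ifP; lia. Qed.

(** The number A_v: [K] gives the k_v and [cp] the capacities, both addressed relative to the root
    of [t]. *)
Fixpoint avail t K (cp : seq nat -> nat) : nat :=
  match t with
  | Leaf _ _ => rdown (K [::]) (cp [::])
  | Node _ ch => rdown (K [::])
      ((fix go (l : seq (tree R)) (i : nat) : nat :=
         match l with
         | [::] => 0
         | u :: l' => avail u (fun x => K (i :: x)) (fun x => cp (i :: x)) + go l' i.+1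
         end) ch 0)%N
  end.

Lemma avail_Node b ch K cp : avail (Node b ch) K cp = rdown (K [::])
  (\sum_(i < size ch) avail (nthd ch i) (fun x => K (val i :: x)) (fun x => cp (val i :: x)))%N.
Proof.
rewrite /=; congr rdown.
set go := (X in X _ 0%N = _).
have goE l m : go l m = (\sum_(0 <= i < size l)
    avail (nthd l i) (fun x => K ((i + m)%N :: x)) (fun x => cp ((i + m)%N :: x)))%N.
  elim: l m => [|u l IH] m; first by rewrite big_nil.
  rewrite big_nat_recl //= add0n IH; congr addn.
  by apply: eq_bigr => i _; rewrite addSnnS.
by rewrite goE big_mkord; apply: eq_bigr => i _; rewrite addn0.
Qed.

Lemma eq_avail t K cp cp' : cp =1 cp' -> avail t K cp = avail t K cp'.
Proof.
elim/tree_nested_ind: t K cp cp' => [c b|b ch IH] K cp cp' E; first by rewrite /= E.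
by rewrite !avail_Node; congr rdown; apply: eq_bigr => i _; apply: IH.
Qed.

Lemma avail_leN t K cp : (avail t K cp <= N)%N.
Proof. by case: t => *; exact: rdown_leN. Qed.

(** A failure is modelled by capacity 0, which keeps the tree and its addresses unchanged. *)
Definition kill (F : seq nat) (cp : seq nat -> nat) (h : seq nat) : nat :=
  if h == F then 0%N else cp h.

Lemma avail_kill_child t K cp i j F :
  avail t K (fun x => kill (j :: F) cp (i :: x)) =
  if i == j then avail t K (kill F (fun x => cp (i :: x)))
  else avail t K (fun x => cp (i :: x)).
Proof.
case: eqP => [->|/eqP ne]; apply: eq_avail => x; rewrite /kill eqseq_cons ?eqxx //.
by rewrite (negbTE ne).
Qed.

Definition embeds t K (C : seq nat -> nat) : Prop :=
  forall x u, sub t x = Some u -> fits (K x) (total u (fun y => C (x ++ y))).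

Lemma embeds_child b ch K C i : (i < size ch)%N -> embeds (Node b ch) K C ->
  embeds (nthd ch i) (fun x => K (i :: x)) (fun x => C (i :: x)).
Proof. by move=> Hi E x u Hu; apply: (E (i :: x)); rewrite sub_Node Hi. Qed.

Lemma leaf_child b ch i h : (i < size ch)%N ->
  h \in leaves (nthd ch i) -> (i :: h) \in leaves (Node b ch).
Proof. by move=> Hi; rewrite !mem_paths sub_Node Hi. Qed.

(** At each node the total of an embedding is an allowed number below the value that gets rounded
    down, hence below the result. *)
Lemma embeds_le_avail t K cp C : {in leaves t, forall h, C h <= cp h}%N ->
  embeds t K C -> (total t C <= avail t K cp)%N.
Proof.
elim/tree_nested_ind: t K cp C => [c b|b ch IH] K cp C Ccp E.
  apply: rdown_max; first exact: (E [::] _ erefl).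
  by rewrite total_Leaf; apply: Ccp; rewrite mem_paths.
rewrite avail_Node; apply: rdown_max; first exact: (E [::] _ erefl).
rewrite total_Node; apply: leq_sum => i _; apply: IH => //.
  by move=> h Hh; apply: Ccp; exact: leaf_child (ltn_ord i) Hh.
exact: embeds_child (ltn_ord i) E.
Qed.

Definition offers t K cp (n : nat) : Prop := exists C,
  [/\ {in leaves t, forall h, C h <= cp h}%N, embeds t K C & total t C = n].

Lemma offers_Node b ch K cp (s : nat -> nat) :
  fits (K [::]) (\sum_(i < size ch) s i) ->
  (forall i, (i < size ch)%N ->
     offers (nthd ch i) (fun x => K (i :: x)) (fun x => cp (i :: x)) (s i)) ->
  offers (Node b ch) K cp (\sum_(i < size ch) s i).
Proof.
move=> fit /(finite_choice (fun=> 0%N))[f Hf].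
pose C h := if h is i :: x then f i x else 0%N.
have tot : total (Node b ch) C = (\sum_(i < size ch) s i)%N.
  by rewrite total_Node; apply: eq_bigr => i _; case: (Hf i (ltn_ord i)).
exists C; split=> //.
  move=> [|i h]; rewrite mem_paths // sub_Node; case: ltnP => // Hi.
  by rewrite -mem_paths => Hh; case: (Hf i Hi) => + _ _; apply.
move=> [|i x] u; first by move=> [<-]; rewrite /= tot.
by rewrite sub_Node; case: ltnP => // Hi Hu; case: (Hf i Hi) => _ /(_ x u Hu).
Qed.

(* With S the sum of the A_u over the children u: either A_v = S >= A_u, or S is
   not allowed and A_v = k_v < N - S <= N - A_u (or S >= N, and n = 0); in all
   cases n <= N - A_u is inherited by the children. *)
Lemma offers_small t K cp n : (n <= avail t K cp)%N -> (n <= N - avail t K cp)%N ->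
  offers t K cp n.
Proof.
elim/tree_nested_ind: t K cp n => [c b|b ch IH] K cp n.
  rewrite /= => n1 n2; exists (fun=> n); split; last by rewrite total_Leaf.
    move=> h; rewrite mem_paths; case: h => // _; exact: leq_trans n1 (rdown_le _ _).
  move=> [|//] u [<-]; rewrite total_Leaf; move: (fits_rdown (K [::]) (cp [::])) n1 n2.
  by rewrite /fits; lia.
rewrite avail_Node.
set a := fun i => avail (nthd ch i) (fun x => K (i :: x)) (fun x => cp (i :: x)).
rewrite -[X in rdown _ X]/(\sum_(i < size ch) a i)%N => n1 n2.
have [s [sa sE]] := split_sum (leq_trans n1 (rdown_le _ _)).
rewrite -sE; apply: offers_Node => [|i Hi].
  rewrite sE; move: (fits_rdown (K [::]) (\sum_(i < size ch) a i)) n1 n2.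
  by rewrite /fits; lia.
apply: IH => //; first exact: sa.
have sn : (s i <= n)%N by rewrite -sE (bigD1 (Ordinal Hi)) //= leq_addr.
have aS : (a i <= \sum_(i < size ch) a i)%N by rewrite (bigD1 (Ordinal Hi)) //= leq_addr.
have := avail_leN (nthd ch i) (fun x => K (i :: x)) (fun x => cp (i :: x)).
rewrite -/(a i); move: aS n1 n2 sn; move: (bigop _ _ _) => S; rewrite /rdown.
by case: ifP; lia.
Qed.

(** If A_v <= N - A_v, [offers_small] suffices. Otherwise the sum S over the children was not cut to
    k_v, since that happens only for k_v < N/2. So either A_v = S and every child gives its A_u, or
    S > N, A_v = N, and the other children complement one of maximal A_u. *)
Lemma offers_avail t K cp : offers t K cp (avail t K cp).
Proof.
elim/tree_nested_ind: t K cp => [c b|b ch IH] K cp.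
  exists (fun=> avail (Leaf c b) K cp); split; last by rewrite total_Leaf.
    move=> h; rewrite mem_paths; case: h => // _; exact: rdown_le.
  by move=> [|//] u [<-]; rewrite total_Leaf fits_rdown.
have [small|big] := leqP (avail (Node b ch) K cp) (N - avail (Node b ch) K cp).
  exact: offers_small.
move: big; rewrite avail_Node.
set a := fun i => avail (nthd ch i) (fun x => K (i :: x)) (fun x => cp (i :: x)).
rewrite -[X in rdown _ X]/(\sum_(i < size ch) a i)%N => big.
have fit := fits_rdown (K [::]) (\sum_(i < size ch) a i).
have [le|gt] := leqP (\sum_(i < size ch) a i) N.
  have E : rdown (K [::]) (\sum_(i < size ch) a i) = (\sum_(i < size ch) a i)%N.
    move: big le; rewrite /rdown; move: (bigop _ _ _) => S; case: ifP; lia.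
  by rewrite E in fit *; apply: offers_Node => // i Hi; apply: IH.
have E : rdown (K [::]) (\sum_(i < size ch) a i) = N.
  by move: gt big; rewrite /rdown; move: (bigop _ _ _) => S; case: ifP; lia.
rewrite E in fit *.
have pos : (0 < size ch)%N.
  by case: (size ch) gt => //; rewrite big_ord0.
have [j _ jmax] := arg_maxnP (fun i : 'I_(size ch) => a i) (erefl true : predT (Ordinal pos)).
have aN i : (a i <= N)%N by exact: avail_leN.
have [|s [sa sE]] := @split_sum (size ch) (N - a j) (fun i => if i == j then 0 else a i)%N.
  move: gt; rewrite (bigD1 j) //= => gt.
  rewrite (bigD1 j) //= eqxx add0n (eq_bigr (fun i : 'I__ => a i)); first by lia.
  by move=> i; rewrite -val_eqE /= => /negbTE ->.
have sj : s j = 0%N by move: (sa _ (ltn_ord j)); rewrite eqxx; lia.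
pose s' i := if i == val j then a j else s i.
have s'E : (\sum_(i < size ch) s' i)%N = N.
  rewrite (bigD1 j) //= /s' eqxx.
  have := sE; rewrite (bigD1 j) //= sj add0n => Es.
  rewrite (eq_bigr (fun i : 'I__ => s i)) ?Es; first by have := aN j; lia.
  by move=> i; rewrite -val_eqE /= => /negbTE ->.
rewrite -{1}s'E; apply: offers_Node => [|i Hi]; first by rewrite s'E.
rewrite /s'; case: eqP => [->|/eqP /negbTE ne]; first exact: (IH _ (ltn_ord j)).
apply: offers_small; first by have := sa i Hi; rewrite ne.
(* Maximality of [a j] gives s_i <= N - a_j <= N - a_i, the second condition of [offers_small]. *)
have h1 : (s i <= N - a j)%N by rewrite -sE (bigD1 (Ordinal Hi)) //= leq_addr.
have h2 := jmax (Ordinal Hi) isT; rewrite -/(a i); move: h1 h2 => /=; lia.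
Qed.

End Availability.

(** * The tables bound every placement from below *)

Section MinPlus.
Variable N : nat.
Local Notation xtable := (nat -> nat -> xnat).

Definition xle (a : xnat) (m : nat) : bool := if a is Some v then (v <= m)%N else false.

Lemma xminl_le s a m : a \in s -> xle a m -> xle (xminl s) m.
Proof.
elim: s => //= x s IH; rewrite inE => /orP[/eqP->|/IH{}IH].
  by case: x (xminl s) {IH} => [v|] [w|] //=; rewrite geq_min => ->.
by move=> /IH; case: x (xminl s) {IH} => [v|] [w|] //= h; rewrite geq_min h orbT.
Qed.

Lemma xminl_in s : xminl s <> None -> xminl s \in s.
Proof.
elim: s => //= x s IH; case E : (xminl s) IH => [w|] IH; last first.
  by case: x => // v _; rewrite mem_head.
have {}IH : Some w \in s by exact: IH.
case: x => [v|] _ /=; last by rewrite inE IH orbT.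
by case: (leqP v w) => _; rewrite inE ?eqxx // IH orbT.
Qed.

Definition combines x0 x1 y0 y1 z0 z1 : bool :=
  [&& x0 <= N, x1 <= N, y0 <= N, y1 <= N, z0 <= x0 + y0
    & z1 <= minn (x0 + y1) (y0 + x1)]%N.

Lemma mem_pairs x y : ((x, y) \in pairs N) = (x <= N)%N && (y <= N)%N.
Proof.
have mr z : (z \in rng N) = (z <= N)%N by rewrite mem_iota.
apply/idP/idP => [/allpairsP[[a b] /= [Ha Hb [-> ->]]]|/andP[hx hy]].
  by rewrite -!mr Ha.
by apply/allpairsP; exists (x, y); rewrite !mr.
Qed.

Lemma step_le (g f : xtable) x0 x1 y0 y1 z0 z1 m1 m2 :
  combines x0 x1 y0 y1 z0 z1 -> xle (g x0 x1) m1 -> xle (f y0 y1) m2 ->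
  xle (step N g f z0 z1) (m1 + m2)%N.
Proof.
move=> /and5P[x0N x1N y0N y1N /andP[h0 h1]] hg hf.
apply: (@xminl_le _ (xadd (g x0 x1) (f y0 y1))); last first.
  by case: (g x0 x1) (f y0 y1) hg hf => [v|] [w|] //= ? ?; apply: leq_add.
apply/mapP; exists ((x0, x1), (y0, y1)) => //.
rewrite mem_filter h0 h1; apply/allpairsP.
by exists ((x0, x1), (y0, y1)); rewrite !mem_pairs /= x0N x1N y0N y1N.
Qed.

Lemma step_attained (g f : xtable) z0 z1 : step N g f z0 z1 <> None ->
  exists x0 x1 y0 y1, combines x0 x1 y0 y1 z0 z1 /\
    step N g f z0 z1 = xadd (g x0 x1) (f y0 y1).
Proof.
move=> /xminl_in /mapP[[[x0 x1] [y0 y1]]]; rewrite mem_filter => /andP[/andP[h0 h1]].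
move=> /allpairsP[[[a b] [c d]] /= []].
rewrite !mem_pairs => /andP[? ?] /andP[? ?] [? ? ? ?] E; subst.
by exists a, b, c, d; split => //; apply/and5P; split => //; rewrite h0.
Qed.

Lemma Npr_S (fs : seq xtable) i : (i < size fs)%N ->
  Npr N fs i.+1 = step N (Npr N fs i) (nth base fs i).
Proof. by move=> h; rewrite /Npr (take_nth base) // foldl_rcons. Qed.

(* [b j] is what child [j] still offers under the worst failure inside it. *)
Lemma Npr_le (fs : seq xtable) (a b m : nat -> nat) (k z0 z1 : nat) :
  (k <= size fs)%N ->
  (forall i, (i < k)%N ->
     [/\ (a i <= N)%N, (b i <= a i)%N & xle (nth base fs i (a i) (b i)) (m i)]) ->
  (z0 <= N)%N -> (z1 <= N)%N ->
  (z0 <= \sum_(i < k) a i)%N -> (z1 <= \sum_(i < k) a i)%N ->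
  (forall j, (j < k)%N -> (z1 <= \sum_(i < k) (if val i == j then b i else a i))%N) ->
  xle (Npr N fs k z0 z1) (\sum_(i < k) m i)%N.
Proof.
elim: k z0 z1 => [|k IH] z0 z1 kf H z0N z1N.
  rewrite !big_ord0 !leqn0 => /eqP-> /eqP-> _.
  by rewrite /Npr take0 /= /base.
have [aN ba xk] := H k (ltnSn k).
rewrite Npr_S // !big_ord_recr /= => hz0 hz1 hF.
pose S := (\sum_(i < k) a i)%N; pose SF j := (\sum_(i < k) (if val i == j then b i else a i))%N.
have hFk : (z1 <= S + b k)%N.
  have := hF k (ltnSn k); rewrite big_ord_recr /= eqxx (eq_bigr (fun i : 'I_k => a i)) //.
  by move=> i _; rewrite ltn_eqF.
have hFj j : (j < k)%N -> (z1 <= SF j + a k)%N.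
  move=> jk; have := hF j (ltnW jk); rewrite big_ord_recr /= ifF //.
  by apply/negbTE; rewrite gtn_eqF.
(* The first [k] children use the entry (min(N,S), x1): it is capped at N, where the tables end, and
   x1 is the least of this cap and of their totals after one failure. *)
have [x1 [x1x0 x1F x1E]] := least_value k (minn N S) SF.
apply: (@step_le _ _ (minn N S) x1 (a k) (b k)) => //.
  rewrite -/S in hz0 hz1.
  have x1z : (z1 <= a k + x1)%N.
    by case: x1E => [->|[j jk ->]]; [lia|rewrite addnC; exact: hFj].
  by rewrite /combines; lia.
apply: IH; rewrite -/S; try lia.
- by move=> i ik; apply: H; exact: ltnW.
- exact: x1F.
Qed.

End MinPlus.

(** * Integer form of the bandwidth conditions and the lower bound *)

Section Tables.
Variables (R : realType) (N : nat) (B : R).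
Hypothesis B0 : 0 < B.
Implicit Types (t u : tree R) (ch : seq (tree R)) (b : R).
Notation nthd ch i := (nth (d0 R) ch i).

Definition slack b : nat := Num.truncn (b / B).

Lemma slackP b n : 0 <= b -> (n <= slack b)%N = (n%:R * B <= b).
Proof.
by move=> b0; rewrite truncn_ge_nat ?divr_ge0 ?(ltW B0) // ler_pdivlMr.
Qed.

Lemma inLamE b x : 0 <= b -> (x <= N)%N ->
  inLam N B b x = (minn x (N - x) <= slack b)%N.
Proof.
move=> b0 xN; rewrite geq_min !truncn_ge_nat ?divr_ge0 ?(ltW B0) //.
by rewrite /inLam natrB // lerBlDl lerBlDr.
Qed.

(** Outside Lambda_v, ceil(N - b/B) equals N - floor(b/B). *)
Lemma mvE b x : 0 <= b -> (x <= N)%N -> mv N B b x = rup N (slack b) x.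
Proof.
move=> b0 xN; rewrite /mv inLamE // /rup; case: ifP => // /negbT xk.
have kN : (slack b <= N)%N by move: xk; lia.
rewrite /lam (@ceil_def _ _ (Posz (N - slack b))) //.
have /andP[lo hi] := truncn_itv (divr_ge0 b0 (ltW B0)).
have E : ((N - slack b)%N%:Z)%:~R = N%:R - (slack b)%:R :> R by rewrite -natrB.
rewrite intrB E lerD2l lerN2 lo andbT -addrA ltrD2l -opprD ltrN2.
by rewrite [_ + _%:~R]natr1.
Qed.

Lemma leaf_tabE c b n0 n1 : 0 <= b -> (n0 <= N)%N -> leaf_tab N B c b n0 n1 =
  if (n1 == 0%N) && (rup N (slack b) n0 <= c)%N then Some (rup N (slack b) n0) else None.
Proof.
move=> b0 nN; rewrite /leaf_tab -(mvE b0 nN) /mv; case: eqP => //= _.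
by case: inLam; rewrite ?andbT ?andbF //=; case: ifP.
Qed.

Lemma Npr_tab_S ch i : (i < size ch)%N ->
  Npr N (map (tab N B) ch) i.+1 =
  step N (Npr N (map (tab N B) ch) i) (tab N B (nthd ch i)).
Proof. by move=> h; rewrite Npr_S ?size_map // (nth_map (d0 R)). Qed.

Definition bw_nonneg t := forall x u, sub t x = Some u -> 0 <= bwd u.

Lemma bw_nonneg_child b ch i : (i < size ch)%N ->
  bw_nonneg (Node b ch) -> bw_nonneg (nthd ch i).
Proof. by move=> Hi h x u Hu; apply: (h (i :: x)); rewrite sub_Node Hi. Qed.

(** [Npr_le] is applied to the child entries (a_i, w_i), where a_i is A_u for the i-th child u and
    w_i its value after the worst failure inside u. Rounding up is harmless: A_v is allowed, so if
    it is at least n it is at least m_v(n) ([rup_le]), and so is the sum over the children. *)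
Lemma tab_le t K C x0 x1 : bw_nonneg t ->
  (forall x u, sub t x = Some u -> K x = slack (bwd u)) ->
  (forall h c b, sub t h = Some (Leaf c b) -> (C h <= c)%N) ->
  (x0 <= N)%N -> (x1 <= N)%N ->
  (x0 <= avail N t K C)%N -> (x1 <= avail N t K C)%N ->
  {in leaves t, forall F, (x1 <= avail N t K (kill F C))%N} ->
  xle (tab N B t x0 x1) (total t C).
Proof.
elim/tree_nested_ind: t K C x0 x1 => [c b|b ch IH] K C x0 x1 nn KE CE x0N x1N h0 h1 hF.
  have b0 := nn [::] _ erefl; rewrite /= in b0.
  rewrite /= leaf_tabE // total_Leaf.
  have Kb : K [::] = slack b := KE [::] _ erefl.
  have Cc := CE [::] _ _ erefl.
  (* The failure of the PM itself leaves it with capacity 0. *)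
  have -> : x1 = 0%N.
    have := hF [::]; rewrite mem_paths => /(_ isT) /=.
    by rewrite /kill /= => /leq_trans/(_ (rdown_le _ _ _)); rewrite leqn0 => /eqP.
  move: h0; rewrite /= Kb => /rup_le /leq_trans /(_ (rdown_le _ _ _)) h.
  by rewrite (leq_trans h).
have b0 : 0 <= b := nn [::] _ erefl.
have Kb : K [::] = slack b := KE [::] _ erefl.
pose Ci i x := C (i :: x); pose Ki i x := K (i :: x).
pose a i := avail N (nthd ch i) (Ki i) (Ci i).
pose worst i y := [/\ (y <= a i)%N,
    {in leaves (nthd ch i), forall F, (y <= avail N (nthd ch i) (Ki i) (kill F (Ci i)))%N} &
    y = a i \/ exists2 F, F \in leaves (nthd ch i) &
                         y = avail N (nthd ch i) (Ki i) (kill F (Ci i))].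
have [w wP] : exists w : nat -> nat, forall i, (i < size ch)%N -> worst i (w i).
  apply: (@finite_choice _ 0%N _ worst) => i Hi; rewrite /worst.
  pose L := leaves (nthd ch i); pose g F := avail N (nthd ch i) (Ki i) (kill F (Ci i)).
  (* Starting the minimum at [a i] enforces w_i <= a_i and covers a child without PMs. *)
  have [y [ya yg yE]] := least_value (size L) (a i) (fun j => g (nth [::] L j)).
  exists y; split => //.
    by move=> F FL; rewrite -[F](nth_index [::] FL); apply: yg; rewrite index_mem.
  case: yE => [->|[j jL ->]]; [by left|right].
  by exists (nth [::] L j) => //; apply: mem_nth.
rewrite /= !mvE // total_Node.
move: h0 h1 hF; rewrite avail_Node Kb -[X in rdown _ _ X]/(\sum_(i < size ch) a i)%N.
move=> /rup_le h0 /rup_le h1 hF.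
have S0 := leq_trans h0 (rdown_le _ _ _); have S1 := leq_trans h1 (rdown_le _ _ _).
have hF' j F : (j < size ch)%N -> F \in leaves (nthd ch j) ->
  (rup N (slack b) x1 <= \sum_(i < size ch)
     (if val i == j then avail N (nthd ch i) (Ki i) (kill F (Ci i)) else a i))%N.
  move=> Hj HF; have := hF (j :: F) (leaf_child b Hj HF).
  rewrite avail_Node Kb => /rup_le /leq_trans /(_ (rdown_le _ _ _)).
  by under eq_bigr => i _ do rewrite avail_kill_child.
apply: (@Npr_le N _ a w (fun i => total (nthd ch i) (Ci i))) => //.
- by rewrite size_map.
- move=> i Hi; have [wa wF wE] := wP i Hi; have aN : (a i <= N)%N by exact: avail_leN.
  split => //; rewrite (nth_map (d0 R)) //; apply: (IH i Hi (Ki i)) => //.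
  + exact: bw_nonneg_child nn.
  + by move=> x u Hu; apply: KE; rewrite sub_Node Hi.
  + by move=> h c' b' Hu; apply: (CE (i :: h) c' b'); rewrite sub_Node Hi.
  + exact: leq_trans wa aN.
- exact: leq_trans h0 (rdown_leN _ _ _).
- exact: leq_trans h1 (rdown_leN _ _ _).
(* If [w j] is [a j], the bound without failure applies; otherwise [w j] is attained by the failure
   of an actual PM [F], to which [hF'] applies. *)
move=> j Hj; have [_ _ [E|[F HF E]]] := wP j Hj.
  apply: leq_trans S1 _; apply: leq_sum => i _.
  by case: eqP => // ->; rewrite E.
apply: leq_trans (hF' j F Hj HF) _; apply: leq_sum => i _.
by case: eqP => // ->; rewrite E.
Qed.

End Tables.

(** * Backtracking *)

Section Backtracking.
Variables (R : realType) (N : nat) (B : R).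
Hypothesis B0 : 0 < B.
Implicit Types (t u : tree R) (ch : seq (tree R)) (b : R).
Implicit Types (C : seq nat -> nat) (Bs : seq nat -> R).
Notation nthd ch i := (nth (d0 R) ch i).

(** A named copy of the anonymous fixpoint in [BT] and [BT_root], so that [BT_Node] and [BT_rootE]
    hold by conversion. *)
Definition each_child (P Q : tree R -> nat -> Prop) :=
  fix go (l : seq (tree R)) (i : nat) : Prop :=
    match l with
    | [::] => True
    | u :: l' => P u i /\ Q u i /\ go l' i.+1
    end.

Lemma each_childP P Q l m : each_child P Q l m <->
  forall i, (i < size l)%N -> P (nthd l i) (i + m)%N /\ Q (nthd l i) (i + m)%N.
Proof.
elim: l m => [|u l IH] m; first by split.
split=> [[Pu [Qu /IH h]] [|i] // Hi|h]; first by rewrite addSnnS; apply: h.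
have [Pu Qu] := h 0%N isT; split=> //; split=> //.
by apply/IH => i Hi; rewrite -addSnnS; apply: (h i.+1).
Qed.

Definition BT_children ch (p : seq nat) z0 z1 C Bs : Prop :=
  exists s0 s1 q0 q1 : nat -> nat,
    s0 (size ch) = z0 /\ s1 (size ch) = z1 /\ s0 0%N = 0%N /\ s1 0%N = 0%N /\
    each_child
      (fun u i => choice_ok N (map (tab N B) ch) (tab N B u) i (s0 i) (s1 i) (q0 i) (q1 i)
                            (s0 i.+1) (s1 i.+1))
      (fun u i => BT N B u (rcons p i) (q0 i) (q1 i) C Bs) ch 0.

Lemma BT_Node b ch p n0 n1 C Bs : BT N B (Node b ch) p n0 n1 C Bs =
  (Bs p = bwreq N B (mv N B b n0) (mv N B b n1) /\
   BT_children ch p (mv N B b n0) (mv N B b n1) C Bs).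
Proof. by []. Qed.

Lemma BT_rootE ch C Bs : BT_root N B ch C Bs = BT_children ch [::] N N C Bs.
Proof. by []. Qed.

(** Lets each child be treated as a tree of its own, rooted at the empty address. *)
Lemma BT_shift t p q n0 n1 C Bs : BT N B t (p ++ q) n0 n1 C Bs <->
  BT N B t q n0 n1 (fun x => C (p ++ x)) (fun x => Bs (p ++ x)).
Proof.
elim/tree_nested_ind: t q n0 n1 => [c b|b ch IH] q n0 n1 //.
rewrite !BT_Node; split=> -[E [s0 [s1 [q0 [q1 [e1 [e2 [e3 [e4 /each_childP h]]]]]]]]];
  split=> //; exists s0, s1, q0, q1; do 4!split=> //; apply/each_childP => i Hi;
  have [hc hB] := h i Hi; split=> //; move: hB; rewrite rcons_cat; apply IH.
all: exact: Hi.
Qed.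

Lemma BT_childrenP ch z0 z1 C Bs : BT_children ch [::] z0 z1 C Bs <->
  exists s0 s1 q0 q1 : nat -> nat,
    [/\ s0 (size ch) = z0, s1 (size ch) = z1, s0 0%N = 0%N, s1 0%N = 0%N &
    forall i, (i < size ch)%N ->
      choice_ok N (map (tab N B) ch) (tab N B (nthd ch i)) i (s0 i) (s1 i) (q0 i) (q1 i)
                (s0 i.+1) (s1 i.+1) /\
      BT N B (nthd ch i) [::] (q0 i) (q1 i) (fun x => C (i :: x)) (fun x => Bs (i :: x))].
Proof.
split=> -[s0 [s1 [q0 [q1]]]].
  move=> [e1 [e2 [e3 [e4 /each_childP h]]]]; exists s0, s1, q0, q1; split=> // i Hi.
  have := h i Hi; rewrite addn0 => -[hc hB]; split=> //.
  by apply/(@BT_shift _ [:: i] [::]).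
move=> [e1 e2 e3 e4 h]; exists s0, s1, q0, q1; do 4!split=> //.
apply/each_childP => i Hi; rewrite addn0; have [hc hB] := h i Hi; split=> //.
by apply/(@BT_shift _ [:: i] [::]).
Qed.

(** A finite minimum is attained, so choices can be traced back from stage [k]; the base table is
    finite only at (0,0), where the trace must end. *)
Lemma choices_exist ch k z0 z1 : (k <= size ch)%N ->
  Npr N (map (tab N B) ch) k z0 z1 <> None ->
  exists s0 s1 q0 q1 : nat -> nat,
    [/\ s0 k = z0, s1 k = z1, s0 0%N = 0%N, s1 0%N = 0%N &
    forall i, (i < k)%N ->
      choice_ok N (map (tab N B) ch) (tab N B (nthd ch i)) i (s0 i) (s1 i) (q0 i) (q1 i)
                (s0 i.+1) (s1 i.+1)].
Proof.
elim: k z0 z1 => [|k IH] z0 z1 kch.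
  rewrite /Npr take0 /= /base; case: eqP => [->|//]; case: eqP => [->|//] _.
  by exists (fun=> 0%N), (fun=> 0%N), (fun=> 0%N), (fun=> 0%N).
move=> ne; have := ne; rewrite {1}Npr_tab_S // => /step_attained.
move=> [x0 [x1 [y0 [y1 [comb E]]]]]; rewrite -Npr_tab_S // in E.
have [||s0 [s1 [q0 [q1 [e1 e2 e3 e4 h]]]]] := IH x0 x1.
- exact: ltnW.
- by move=> E0; apply: ne; rewrite E E0.
exists (fun i => if i == k.+1 then z0 else s0 i), (fun i => if i == k.+1 then z1 else s1 i),
  (fun i => if i == k then y0 else q0 i), (fun i => if i == k then y1 else q1 i).
rewrite !eqxx; split=> // i; rewrite ltnS => ik; rewrite ltn_eqF ?ltnS // eqSS.
case: eqP => [->|/eqP ne']; first by rewrite e1 e2; split.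
by apply: h; rewrite ltn_neqAle ne'.
Qed.

(** [r] prescribes the value on the link of the switch itself, which the children leave free. *)
Lemma BT_children_exist ch z0 z1 :
  (forall i n0 n1, (i < size ch)%N -> tab N B (nthd ch i) n0 n1 <> None ->
     exists CB : (seq nat -> nat) * (seq nat -> R), BT N B (nthd ch i) [::] n0 n1 CB.1 CB.2) ->
  Npr N (map (tab N B) ch) (size ch) z0 z1 <> None ->
  forall r, exists CB : (seq nat -> nat) * (seq nat -> R),
    BT_children ch [::] z0 z1 CB.1 CB.2 /\ CB.2 [::] = r.
Proof.
move=> IH /(choices_exist (leqnn _))[s0 [s1 [q0 [q1 [e1 e2 e3 e4 h]]]]] r.
have [|f Hf] := @finite_choice _ (fun=> 0%N, fun=> 0) (size ch)
  (fun i CB => BT N B (nthd ch i) [::] (q0 i) (q1 i) CB.1 CB.2).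
  move=> i Hi; apply: IH => // E.
  by have [_ [ne]] := h i Hi; rewrite E; case: (Npr _ _ i _ _) => //= ? /ne.
exists (fun h => if h is i :: x then (f i).1 x else 0%N,
        fun h => if h is i :: x then (f i).2 x else r); split=> //.
apply/BT_childrenP; exists s0, s1, q0, q1; split=> // i Hi.
by split; [exact: h|exact: Hf].
Qed.

Lemma BT_exists t n0 n1 : tab N B t n0 n1 <> None ->
  exists CB : (seq nat -> nat) * (seq nat -> R), BT N B t [::] n0 n1 CB.1 CB.2.
Proof.
elim/tree_nested_ind: t n0 n1 => [c b|b ch IH] n0 n1 /=.
  case E: leaf_tab => [k|//] _.
  exists (fun=> k, fun=> bwreq N B (mv N B b n0) (mv N B b n1)).
  by split=> //; exists k.
move=> /(BT_children_exist (fun i n0 n1 Hi => IH i Hi n0 n1)).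
move=> /(_ (bwreq N B (mv N B b n0) (mv N B b n1)))[CB [h E]].
by exists CB; exact: (conj E h).
Qed.

(** The k_v for the bandwidths chosen by the backtracking. *)
Definition Bslack Bs (x : seq nat) : nat := slack B (Bs x).

Lemma slack_bwreq a0 a1 :
  slack B (bwreq N B a0 a1) = maxn (minn a0 (N - a0)) (minn a1 (N - a1)).
Proof. by rewrite /slack /bwreq mulrC mulKf ?gt_eqF // natrK. Qed.

Lemma bwreq_bounds b n0 n1 : 0 <= b -> (n0 <= N)%N -> (n1 <= N)%N ->
  0 <= bwreq N B (mv N B b n0) (mv N B b n1) <= b.
Proof.
move=> b0 n0N n1N; rewrite mulr_ge0 ?(ltW B0) //= /bwreq mulrC -slackP // !mvE //.
have := @fits_rup N (slack B b) n0 n0N; have := @fits_rup N (slack B b) n1 n1N.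
by rewrite /fits; lia.
Qed.

(** The chosen bandwidth is the larger of the needs of m_v(n0) and m_v(n1), so both are allowed
    under it; by induction the children offer at least these totals, without failure and after any
    one. Rounding down thus keeps A_v above them, even with the chosen bandwidths in place of the
    available ones. *)
Lemma BT_sound t n0 n1 C Bs : bw_nonneg t -> (n0 <= N)%N -> (n1 <= N)%N ->
  BT N B t [::] n0 n1 C Bs ->
  [/\ tab N B t n0 n1 = Some (total t C),
      forall h c b, sub t h = Some (Leaf c b) -> (C h <= c)%N,
      forall x u, sub t x = Some u -> 0 <= Bs x <= bwd u,
      (n0 <= avail N t (Bslack Bs) C)%N &
      {in leaves t, forall F, (n1 <= avail N t (Bslack Bs) (kill F C))%N}].
Proof.
elim/tree_nested_ind: t n0 n1 C Bs => [c b|b ch IH] n0 n1 C Bs nn n0N n1N.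
  have b0 : 0 <= b := nn [::] _ erefl.
  move=> [[k [E Ck]] EB]; rewrite /= E total_Leaf Ck.
  move: E; rewrite leaf_tabE //; case: eqP => //= n10; case: ifP => // le [kE].
  split=> //.
  - by move=> [|//] c' b' [<- _]; rewrite Ck -kE.
  - by move=> [|//] u [<-]; rewrite EB; exact: bwreq_bounds.
  - apply: leq_trans (rup_ge (slack B b) n0N) _; apply: rdown_max; last by rewrite kE.
    rewrite /Bslack EB slack_bwreq (mvE B0 b0 n0N); have := @fits_rup N (slack B b) n0 n0N.
    by rewrite /fits => /andP[-> _]; rewrite leq_max leqnn.
  - by rewrite n10.
have b0 : 0 <= b := nn [::] _ erefl.
rewrite BT_Node => -[EB /BT_childrenP[s0 [s1 [q0 [q1 [e1 e2 e30 e31 h]]]]]].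
pose Ci i x := C (i :: x); pose Bi i x := Bs (i :: x).
have q0N i : (i < size ch)%N -> (q0 i <= N)%N.
  by move=> Hi; have [[/and5P[_ _ ->]]] := h i Hi.
have q1N i : (i < size ch)%N -> (q1 i <= N)%N.
  by move=> Hi; have [[/and5P[_ _ _ ->]]] := h i Hi.
have H i (Hi : (i < size ch)%N) :=
  IH i Hi (q0 i) (q1 i) (Ci i) (Bi i) (bw_nonneg_child Hi nn) (q0N i Hi) (q1N i Hi) (h i Hi).2.
have costE k : (k <= size ch)%N -> Npr N (map (tab N B) ch) k (s0 k) (s1 k) =
    Some (\sum_(i < k) total (nthd ch i) (Ci i))%N.
  elim: k => [|k IHk] Hk; first by rewrite /Npr take0 big_ord0 e30 e31.
  have [[_ [_ ->]] _] := h k Hk; have [-> _ _ _ _] := H k Hk.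
  by rewrite IHk ?(ltnW Hk) //= big_ord_recr.
have sum0 k : (k <= size ch)%N -> (s0 k <= \sum_(i < k) q0 i)%N.
  elim: k => [|k IHk] Hk; first by rewrite e30.
  rewrite big_ord_recr /=; have [[/and5P[_ _ _ _ /andP[le _]] _] _] := h k Hk.
  by apply: leq_trans le _; rewrite leq_add2r IHk // ltnW.
have sum1 k j : (k <= size ch)%N -> (j < k)%N ->
    (s1 k <= \sum_(i < k) (if val i == j then q1 i else q0 i))%N.
  elim: k => [|k IHk] // Hk; rewrite ltnS leq_eqVlt big_ord_recr /=.
  have [[/and5P[_ _ _ _ /andP[_]]]] := h k Hk; rewrite leq_min => /andP[le0 le1] _ _.
  (* If the failing child is the last one added, the earlier ones are intact and the first term of
     the minimum in [choice_ok] applies; otherwise the second term and the induction hypothesis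
     do. *)
  case: eqP => [->|_] /= jk.
    rewrite eqxx; apply: leq_trans le0 _; rewrite leq_add2r.
    apply: leq_trans (sum0 k (ltnW Hk)) _; apply: leq_sum => i _.
    by rewrite ltn_eqF.
  rewrite gtn_eqF //; apply: leq_trans le1 _.
  by rewrite addnC leq_add2r; apply: IHk => //; exact: ltnW.
have fitE (n : nat) : n = mv N B b n0 \/ n = mv N B b n1 -> fits N (Bslack Bs [::]) n.
  rewrite /Bslack EB slack_bwreq !mvE //.
  have := @fits_rup N (slack B b) n0 n0N; have := @fits_rup N (slack B b) n1 n1N.
  by rewrite /fits => ? ? [] ->; lia.
have mvge n : (n <= N)%N -> (n <= mv N B b n)%N by move=> nN; rewrite mvE // rup_ge.
split.
- by rewrite total_Node -costE //= e1 e2.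
- move=> [|i x] c' b' //; rewrite sub_Node; case: ltnP => // Hi Hu.
  by have [_ hc _ _ _] := H i Hi; exact: hc Hu.
- move=> [|i x] u; first by move=> [<-]; rewrite EB; exact: bwreq_bounds.
  by rewrite sub_Node; case: ltnP => // Hi Hu; have [_ _ hb _ _] := H i Hi; exact: hb Hu.
- apply: leq_trans (mvge _ n0N) _; rewrite avail_Node; apply: rdown_max; first by apply: fitE; left.
  rewrite -e1; apply: leq_trans (sum0 _ (leqnn _)) _; apply: leq_sum => i _.
  by have [_ _ _ ha _] := H i (ltn_ord i).
move=> [|j F]; rewrite mem_paths // sub_Node; case: ltnP => // Hj; rewrite -mem_paths => HF.
apply: leq_trans (mvge _ n1N) _; rewrite avail_Node; apply: rdown_max; first by apply: fitE; right.
rewrite -e2; apply: leq_trans (sum1 _ j (leqnn _) Hj) _; apply: leq_sum => i _.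
rewrite avail_kill_child; have [_ _ _ ha hF] := H i (ltn_ord i).
by case: eqP => [E|_]; [apply: hF; rewrite -E in HF|].
Qed.

End Backtracking.

(** * Survivable embeddings of the whole substrate *)

Section Survivability.
Variables (R : realType) (N : nat) (B : R) (ch : seq (tree R)).
Hypotheses (B0 : 0 < B) (bwt_ge0 : forall v, v \in addrs ch -> 0 <= bwt ch v).
Implicit Types (u : tree R) (C Cs : seq nat -> nat) (Bs : seq nat -> R) (F v : seq nat).

(* A link of bandwidth N * B never constrains anything, so the root can be
   treated as an ordinary switch. *)
Definition root_switch : tree R := Node (N%:R * B) ch.

Lemma pms_root : pms ch = leaves root_switch.
Proof. by []. Qed.

Lemma addrs_root v : (v \in addrs ch) = (v != [::]) && sub root_switch v.
Proof.
have E : paths predT root_switch = [::] :: addrs ch.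
  by rewrite /paths /addrs filter_predT.
case: v => [|i v].
  have := E; rewrite paths_Node => -[<-].
  by apply/negbTE/flattenP => -[s /mapP[i _ ->]] /mapP[].
have := mem_paths predT root_switch (i :: v); rewrite E inE /= => ->.
by case: obind.
Qed.

Lemma bwt_root v u : v \in addrs ch -> sub root_switch v = Some u -> bwt ch v = bwd u.
Proof.
rewrite addrs_root => /andP[v0 _]; case: v v0 => // i v _ Hu.
by rewrite /bwt -[sub _ _]/(sub root_switch (i :: v)) Hu.
Qed.

Lemma bw_nonneg_root : bw_nonneg root_switch.
Proof.
move=> [|i v] u Hu; first by case: Hu => <-; rewrite mulr_ge0 // ltW.
have Ha : (i :: v) \in addrs ch by rewrite addrs_root Hu.
by rewrite -(bwt_root Ha Hu); exact: bwt_ge0.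
Qed.

Lemma mv_root : mv N B (N%:R * B) N = N.
Proof.
by rewrite mvE ?mulr_ge0 ?(ltW B0) // /rup subnn minn0 leq0n.
Qed.

Lemma tab_root : tab N B root_switch N N = root_tab N B ch N N.
Proof. by rewrite /= !mv_root. Qed.

(** Translates the sums of [VCE], which drops [F] from the list of PMs, into the [kill] model. *)
Lemma sum_alive F (P : pred (seq nat)) C :
  (\sum_(h <- [seq h <- pms ch | Some h != Some F] | P h) C h =
   \sum_(h <- leaves root_switch | P h) kill F C h)%N.
Proof.
rewrite big_filter_cond pms_root [LHS]big_mkcond [RHS]big_mkcond.
apply: eq_bigr => h _; rewrite /kill (_ : (Some h != Some F) = (h != F)) //.
by case: (h == F); case: (P h).
Qed.

Definition root_slack v : nat := if sub root_switch v is Some u then slack B (bwd u) else 0%N.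

(** A VCE respects [Bs], hence the available bandwidths, which define [root_slack]. *)
Lemma SVCE_offers Cs Bs F : SVCE N B ch Cs Bs -> F \in pms ch ->
  offers N root_switch root_slack (kill F Cs) N.
Proof.
move=> [_ [Bb hF]] Fpm; have [C [Cc [CN Cb]]] := hF F Fpm.
have tot : total root_switch (kill F C) = N.
  by have := sum_alive F predT C; rewrite CN => ->.
exists (kill F C); split=> //.
  move=> h Hh; rewrite /kill; case: eqP => // /eqP ne; apply: Cc.
  by rewrite mem_filter pms_root Hh andbT; exact: ne.
move=> v u Hu; have b0 := bw_nonneg_root Hu; rewrite /root_slack Hu.
have vN : (total u (fun x => kill F C (v ++ x)) <= N)%N.
  by rewrite -(total_prefix _ Hu) -[N in (_ <= N)%N]tot /total [X in (X <= _)%N]big_mkcond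
    leq_sum // => h _; case: ifP.
rewrite /fits vN /= slackP //.
(* [VCE] has no condition at [F] or at the root: the former has 0 VMs below it, the latter all N, so
   the minimum is 0 in both cases. *)
have [vF|vF] := eqVneq v F.
  have : v \in leaves root_switch by rewrite vF.
  rewrite mem_paths Hu; case: u Hu b0 vN => // c b _ b0 _ _.
  by rewrite total_Leaf cats0 /kill vF eqxx min0n mul0r.
have [v0|v0] := eqVneq v [::].
  move: Hu b0; rewrite v0 => -[<-] b0.
  rewrite (_ : total _ _ = N) ?subnn ?minn0 ?mul0r //.
have Ha : v \in addrs ch by rewrite addrs_root v0 Hu.
have := Cb v Ha vF; rewrite sum_alive (total_prefix _ Hu) => /le_trans; apply.
by rewrite -(bwt_root Ha Hu); have /andP[] := Bb v Ha.
Qed.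

(** Since A_r bounds every embedding, it is at least N after each failure, and [tab_le] applies. The
    PM [F] supplies an embedding for the case without failure. *)
Lemma SVCE_cost Cs Bs F : SVCE N B ch Cs Bs -> F \in pms ch ->
  xle (root_tab N B ch N N) (cost ch Cs).
Proof.
move=> sv Fpm; rewrite -tab_root /cost pms_root.
have avF G : G \in leaves root_switch -> (N <= avail N root_switch root_slack (kill G Cs))%N.
  move=> HG; have [C [Cc Ce CN]] := SVCE_offers sv HG.
  by rewrite -[X in (X <= _)%N]CN; exact: embeds_le_avail.
apply: (@tab_le _ _ _ B0 _ root_slack) => //.
- exact: bw_nonneg_root.
- by move=> x u Hu; rewrite /root_slack Hu.
- move=> h c b Hu; case: sv => /(_ h) + _.
  by rewrite pms_root mem_paths Hu => /(_ isT); case: h Hu => // i h; rewrite /cap /= => ->.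
all: have [C [Cc Ce CN]] := SVCE_offers sv Fpm; rewrite -[X in (X <= _)%N]CN.
all: apply: embeds_le_avail => // h Hh.
all: by apply: leq_trans (Cc h Hh) _; rewrite /kill; case: ifP.
Qed.

(** By [BT_sound], A_r is at least N after any failure, hence equal to N, and [offers_avail] embeds
    exactly N VMs under the chosen bandwidths. *)
Lemma BT_root_SVCE Cs Bs : BT_root N B ch Cs Bs ->
  SVCE N B ch Cs Bs /\ root_tab N B ch N N = Some (cost ch Cs).
Proof.
rewrite BT_rootE => /BT_childrenP bt.
(* [BT] at [root_switch] also demands the hose bandwidth of the root, which is 0 for a0 = a1 = N. *)
pose Bs' v := if v is [::] then 0 else Bs v.
have : BT N B root_switch [::] N N Cs Bs'.
  rewrite BT_Node mv_root; split; last by apply/BT_childrenP.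
  by rewrite /bwreq subnn minn0 maxnn mulr0.
move=> /(BT_sound B0 bw_nonneg_root (leqnn N) (leqnn N)).
rewrite tab_root => -[-> Cc Bb _ hF]; split=> //.
have BsE v : v \in addrs ch -> Bs' v = Bs v by rewrite addrs_root; case: v.
split; [|split].
- move=> h; rewrite pms_root mem_paths; case Hu: sub => [[c b|//]|//] _.
  rewrite /cap; case: h Hu => // i h Hu; rewrite -[sub _ _]/(sub root_switch (i :: h)) Hu.
  exact: Cc Hu.
- move=> v Ha; have := Ha; rewrite addrs_root => /andP[v0].
  case Hu: sub => [u|//] _; rewrite (bwt_root Ha Hu) -(BsE v Ha); exact: Bb Hu.
move=> F Fpm; have := offers_avail N root_switch (Bslack B Bs') (kill F Cs).
have -> : avail N root_switch (Bslack B Bs') (kill F Cs) = N.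
  by apply/eqP; rewrite eqn_leq avail_leN hF.
move=> [C [Ck Ce CN]]; have killC h : h \in leaves root_switch -> kill F C h = C h.
  by move=> /Ck; rewrite /kill; case: ifP => // _; rewrite leqn0 => /eqP.
exists C; split; [|split].
- move=> h; rewrite mem_filter => /andP[_ /Ck /leq_trans]; apply.
  by rewrite /kill; case: ifP.
- rewrite sum_alive -[RHS]CN; exact: eq_big_seq.
move=> v Ha vF; rewrite sum_alive.
have := Ha; rewrite addrs_root => /andP[_]; case Hu: sub => [u|//] _.
rewrite (_ : \sum_(h <- _ | _) _ = total u (fun x => C (v ++ x)))%N; last first.
  rewrite -(total_prefix _ Hu) big_seq_cond [RHS]big_seq_cond.
  by apply: eq_bigr => h /andP[/killC].
have /andP[_] := Ce v u Hu; rewrite (slackP B0); first by rewrite BsE.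
by have /andP[] := Bb v u Hu.
Qed.

End Survivability.

(** * Correctness of Algorithm 1 *)

Lemma wf_leaf (R : realType) (t : tree R) : wf_tree t -> exists h, h \in leaves t.
Proof.
elim/tree_nested_ind: t => [c b|b ch IH]; first by exists [::]; rewrite mem_paths.
move=> /= /andP[pos /(all_nthP (d0 R)) wf]; have [h Hh] := IH 0%N pos (wf 0%N pos).
by exists (0%N :: h); exact: leaf_child Hh.
Qed.

Theorem theorem1 (R : realType) (ch : seq (tree R)) (N : nat) (B : R) :
  wf_substrate ch ->
  (forall v, v \in addrs ch -> 0 <= bwt ch v) ->
  (0 < N)%N -> 0 < B ->
  (exists res, alg_returns N B ch res) /\
  (forall res, alg_returns N B ch res ->
     match res with
     | Infeasible => ~ (exists Cs Bs, SVCE N B ch Cs Bs)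
     | Solution Cs Bs => optimal_SVCE N B ch Cs Bs
     end).
Proof.
move=> wf bw0 N0 B0.
(* The lower bound rests on a VCE, which an SVCE yields only through the failure of some PM. *)
have [F Fpm] : exists F, F \in pms ch by exact: (wf_leaf (wf : wf_tree (Node 0 ch))).
split.
  case E: (root_tab N B ch N N) => [m|]; last by exists (Infeasible R).
  have [|[C Bs]] := @BT_exists R N B (root_switch N B ch) N N; first by rewrite tab_root // E.
  rewrite BT_Node mv_root // => -[_ bt].
  by exists (Solution C Bs); split=> //; rewrite E.
move=> [E [Cs [Bs sv]]|Cs Bs [_ bt]].
  by have := SVCE_cost B0 bw0 sv Fpm; rewrite /= in E; rewrite E.
have [sv E] := BT_root_SVCE B0 bw0 bt; split=> // Cs' Bs' sv'.
by have := SVCE_cost B0 bw0 sv' Fpm; rewrite E.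
Qed.
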